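(* Let $\Delta_n=\{\lambda\in\mathbb R^n:1\ge\lambda_1\ge\dots\ge\lambda_n\ge-1\}$, and for a vector $e=(e_1,\dots,e_n)$ of positive integers let $$f_n(e)=\int_{\Delta_n}\det\big(\lambda_i^{e_j-1}\big)_{i,j=1}^n\,d\lambda.$$ Let $N_+(e)$ be the number of even entries of $e$ and $N_-(e)$ the number of odd entries. (i) For a permutation $\sigma\in S_n$, $f_n(\sigma e)=(-1)^\sigma f_n(e)$. (ii) If $N_-(e)-N_+(e)\notin\{0,1\}$ then $f_n(e)=0$. (iii) Assume $N_-(e)-N_+(e)\in\{0,1\}$. Then the entries of $e$ can be rearranged such that $e_i\equiv i\bmod 2$ for all $i$, and for $e$ so arranged $$f_n(e)=(-1)^{\binom n2}2^n\,\frac{\displaystyle\prod_{i<j,\ i\equiv j\,(\mathrm{mod}\,2)}(e_j-e_i)}{\displaystyle\prod_{i\equiv1\,(\mathrm{mod}\,2)}e_i\ \prod_{i<j,\ i\not\equiv j\,(\mathrm{mod}\,2)}(e_i+e_j)},$$ where all indices range over $1,\dots,n$.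
   Context: $(-1)^\sigma$ denotes the sign of the permutation $\sigma$, and $\sigma e$ is the vector $e$ with entries permuted by $\sigma$. *)

(* Defs.v *)
From HB Require Import structures.
From mathcomp Require Import all_boot all_order all_algebra all_fingroup.
From mathcomp Require Import all_classical all_reals all_analysis.

Set Implicit Arguments.
Unset Strict Implicit.
Unset Printing Implicit Defensive.

Import Order.TTheory GRing.Theory Num.Theory.

Local Open Scope classical_set_scope.
Local Open Scope ring_scope.

(* A point (lambda_1, ..., lambda_n) of R^n is an n-tuple t with
   tnth t i = lambda_(i+1); n-tuples carry the product of the Borel
   sigma-algebras. *)
Section lebesgue_cons.
Context {R : realType}.
Local Open Scope ereal_scope.
Local Notation B := (measurableTypeR R).
Variable n : nat.

Definition cons_pair (p : B * n.-tuple B) : n.+1.-tuple B :=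
  [tuple of p.1 :: p.2].

Definition uncons_pair (t : n.+1.-tuple B) : B * n.-tuple B :=
  (thead t, [tuple of behead t]).

Lemma cons_pairK : cancel cons_pair uncons_pair.
Proof.
case=> x t; rewrite /uncons_pair /cons_pair/= theadE; congr pair.
exact: val_inj.
Qed.

Lemma uncons_pairK : cancel uncons_pair cons_pair.
Proof. by move=> t; rewrite /cons_pair/= [RHS]tuple_eta. Qed.

Lemma measurable_cons_pair : measurable_fun [set: B * n.-tuple B] cons_pair.
Proof. exact: (measurable_cons (f := fst) (g := snd)). Qed.

Lemma measurable_uncons_pair : measurable_fun [set: n.+1.-tuple B] uncons_pair.
Proof.
apply/measurable_fun_pairP; split; first exact: measurable_tnth.
exact: measurable_behead.
Qed.

HB.instance Definition _ :=
  isMeasurableFun.Build _ _ _ _ cons_pair measurable_cons_pair.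

Variable mu : {sigma_finite_measure set (n.-tuple B) -> \bar R}.

Definition lebesgue_cons : set (n.+1.-tuple B) -> \bar R :=
  pushforward (@lebesgue_measure R \x mu) cons_pair.

Let lebesgue_cons0 : lebesgue_cons set0 = 0. Proof. exact: measure0. Qed.

Let lebesgue_cons_ge0 A : 0 <= lebesgue_cons A. Proof. exact: measure_ge0. Qed.

Let lebesgue_cons_sigma_additive : semi_sigma_additive lebesgue_cons.
Proof. exact: (@measure_semi_sigma_additive _ _ _
  (pushforward (@lebesgue_measure R \x mu) cons_pair)). Qed.

HB.instance Definition _ := isMeasure.Build _ _ _ lebesgue_cons
  lebesgue_cons0 lebesgue_cons_ge0 lebesgue_cons_sigma_additive.

Let lebesgue_cons_sigma_finite : sigma_finite setT lebesgue_cons.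
Proof.
have /sigma_finiteP[F [TF ndF Foo]] := sigma_finiteT (@lebesgue_measure R).
have /sigma_finiteP[G [TG ndG Goo]] := sigma_finiteT mu.
exists (fun i => uncons_pair @^-1` (F i `*` G i)).
  rewrite -preimage_bigcup (_ : \bigcup_i _ = setT) ?preimage_setT//.
  rewrite -setXTT TF TG; apply/seteqP; split => -[x t]/=.
    by move=> [i _ [/= Fx Gt]]; split; exists i.
  move=> [/= [i _ Fx] [j _ Gt]]; exists (maxn i j) => //; split => /=.
    by move: x Fx; exact/subsetPset/ndF/leq_maxl.
  by move: t Gt; exact/subsetPset/ndG/leq_maxr.
move=> i; have [mF Fi] := Foo i; have [mG Gi] := Goo i; split.
  rewrite -[X in measurable X]setTI; apply: measurable_uncons_pair => //.
  exact: measurableX.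
rewrite /lebesgue_cons /pushforward -comp_preimage.
rewrite (_ : uncons_pair \o _ = id); last exact/funext/cons_pairK.
by rewrite preimage_id product_measure1E// lte_mul_pinfty// ge0_fin_numE.
Qed.

HB.instance Definition _ := Measure_isSigmaFinite.Build _ _ _
  lebesgue_cons lebesgue_cons_sigma_finite.

End lebesgue_cons.
Arguments cons_pair {R n}.
Arguments uncons_pair {R n}.

(* The library has no Lebesgue measure on R^n; this is the n-fold product of the
   one-dimensional one (see lebesgue_tuple_box). *)
Fixpoint lebesgue_tuple (R : realType) (n : nat) :
    {sigma_finite_measure set (n.-tuple (measurableTypeR R)) -> \bar R} :=
  match n with
  | 0%N => \d_([tuple] : 0.-tuple (measurableTypeR R))
  | n'.+1 => lebesgue_cons (lebesgue_tuple R n')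
  end.

Lemma lebesgue_tuple_box (R : realType) (n : nat)
    (A : 'I_n -> set (measurableTypeR R)) :
  (forall i, measurable (A i)) ->
  lebesgue_tuple R n [set t | forall i, A i (tnth t i)] =
  (\prod_(i < n) lebesgue_measure (A i))%E.
Proof.
elim: n A => [A _|n IHn A mA].
  by rewrite big_ord0 /= diracE mem_set// => -[].
rewrite big_ord_recl -IHn//= /lebesgue_cons /pushforward.
have -> : cons_pair @^-1` [set t | forall i, A i (tnth t i)] =
    A ord0 `*` [set t | forall i, A (lift ord0 i) (tnth t i)].
  apply/seteqP; split => -[x t]/=.
    move=> h; split; first exact: (h ord0).
    by move=> i; have := h (lift ord0 i); rewrite tnthS.
  move=> [h0 h] i; case: (unliftP ord0 i) => [j|] -> //.
  by rewrite tnthS; exact: h.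
rewrite product_measure1E//.
rewrite (_ : [set t | _] = \bigcap_(i in [set: 'I_n])
   ((fun t : n.-tuple (measurableTypeR R) => tnth t i) @^-1` A (lift ord0 i))).
  apply: fin_bigcap_measurable => // i _.
  by rewrite -[X in measurable X]setTI; exact: measurable_tnth.
by apply/seteqP; split => t /= h i; [move=> _|]; exact: h.
Qed.

(* Writes out the chain 1 >= lambda_1 >= ... >= lambda_n >= -1. *)
Definition Delta (R : realType) (n : nat) : set (n.-tuple (measurableTypeR R)) :=
  [set t | path (fun x y : R => y <= x) 1 (rcons t (-1))].
Arguments Delta : clear implicits.

Definition f_int (R : realType) (n : nat) (e : 'I_n -> nat) : R :=
  \int[lebesgue_tuple R n]_(t in Delta R n)
    \det (\matrix_(i < n, j < n) (tnth t i : R) ^+ (e j - 1)).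
Arguments f_int : clear implicits.
Arguments f_int R {n}.

Definition N_even (n : nat) (e : 'I_n -> nat) : nat := #|[pred i | ~~ odd (e i)]|.

Definition N_odd (n : nat) (e : 'I_n -> nat) : nat := #|[pred i | odd (e i)]|.

(* Left action: the entry e_i is moved to position sigma i. *)
Definition perm_vec (n : nat) (s : 'S_n) (e : 'I_n -> nat) : 'I_n -> nat :=
  fun i => e ((s^-1)%g i).

(* i : 'I_n stands for the index i.+1 in 1, ..., n. *)
Definition parity_arranged (n : nat) (e : 'I_n -> nat) : Prop :=
  forall i : 'I_n, e i = i.+1 %[mod 2].

(* Main.v *)
Require Import Defs.
From mathcomp Require Import all_boot all_order all_algebra all_fingroup.
From mathcomp Require Import all_classical all_reals all_analysis.
From mathcomp Require Import measurable_realfun ring lra zify.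

Set Implicit Arguments.
Unset Strict Implicit.
Unset Printing Implicit Defensive.

Import Order.TTheory GRing.Theory Num.Theory.

Local Open Scope ring_scope.

(** The integral satisfies a recursion in the number of variables.  The
determinant is a homogeneous polynomial, so the divergence of the Euler field
[\sum_i l_i d/dl_i] times the determinant is [\sum_j e_j] times the
determinant.  By the divergence theorem [(\sum_j e_j) f(e)] is the flux
through the boundary of the simplex.  The field is tangent to the faces
[l_i = l_(i+1)]; only [l_1 = 1] and [l_n = -1] contribute, and expanding the
determinant along the constant row gives, for [n + 1] variables indexed from 0,
[[
  (\sum_j e_j) f(e) = \sum_j (-1)^j (1 - (-1)^(n + e_j)) f(e without e_j),
]]
so that only the [e_j] with the parity of [n + 1] survive ([f_int_rec]).

The divergence theorem is replaced by algebra.  When the upper bound 1 of the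
simplex is replaced by a variable, the integral becomes a polynomial
[chain_moment e] in that bound, computed by integrating one variable at a time
([integral_moment_det], which is Fubini plus expansion along the first row).
The flux identity is an identity between such polynomials
([chain_moment_euler]), proved by induction on the number of variables: both
sides have the same derivative and the same value at -1.

Antisymmetry in [e] is that of the determinant in its columns ([f_int_perm]).

The right-hand side of the theorem solves the same recursion.  Up to a sign
depending only on [n] it is a product over pairs [i < j] of an antisymmetric
function of [(e_i, e_j)], times a product over the odd entries
([closedform]).  Deleting [e_j] divides it by an explicit product, and the
recursion becomes the value of a divided difference: for points [y_j] and as
many numbers [z], the sum over [j] of
[\prod_z (y_j - z) / \prod_(k != j) (y_j - y_k)] is [\sum_j y_j - \sum z]
([lagrange_sum]).  Here the [y_j] are the entries with the parity of [n + 1],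
and the [z] are the opposites of the other entries, together with 0 when
[n + 1] is odd.  Since the recursion only deletes entries with the parity of
[n + 1], it preserves the condition that the number of odd entries is
[uphalf n]; when the condition fails, the integral vanishes all the way. *)

(** * Primitives of polynomials *)

Section Primitive.
Variable K : numFieldType.
Implicit Types p q : {poly K}.

Definition primitive0 p : {poly K} :=
  \poly_(i < (size p).+1) (p`_i.-1 / i%:R * (i != 0%N)%:R).

Definition primitive p : {poly K} := primitive0 p - (primitive0 p).[-1]%:P.

Lemma deriv_primitive p : (primitive p)^`() = p.
Proof.
rewrite derivB derivC subr0; apply/polyP => i.
rewrite coef_deriv coef_poly ltnS /= mulr1.
case: ltnP => [_|/(nth_default 0) ->]; last by rewrite mul0rn.
by rewrite -[LHS]mulr_natr -mulrA mulVf ?mulr1 ?pnatr_eq0.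
Qed.

Lemma horner_primitive p : (primitive p).[-1] = 0.
Proof. by rewrite /primitive hornerD hornerN hornerC subrr. Qed.

Lemma poly_eq_deriv p q a : p^`() = q^`() -> p.[a] = q.[a] -> p = q.
Proof.
move=> eq_deriv eq_a; apply/eqP; rewrite -subr_eq0; apply/eqP.
set r := p - q.
have r'0 : r^`() = 0 by rewrite derivB eq_deriv subrr.
have rC : r = (r`_0)%:P.
  apply/polyP => -[|i]; rewrite coefC //=.
  have /eqP := congr1 (fun s : {poly K} => s`_i) r'0.
  by rewrite coef_deriv coef0 mulrn_eq0 /= => /eqP.
have : r.[a] = 0 by rewrite hornerD hornerN eq_a subrr.
by rewrite rC hornerC => ->.
Qed.

End Primitive.

(** * Polynomials given by iterated integrals *)

(** Two indices can be deleted in either order: deleting [j] and then [k] removes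
the same two indices as deleting [lift j k] first.  The total of the two
positions changes parity, because the position of the larger index drops by one
when the smaller one goes first. *)
Lemma lift_lift_swap n (j : 'I_n.+2) (k : 'I_n.+1) :
  {k' : 'I_n.+1 | lift (lift j k) k' = j &
     lift j \o lift k = lift (lift j k) \o lift k' /\
     odd (lift j k + k') = ~~ odd (j + k)}.
Proof.
have [k' jE] : {k' | j = lift (lift j k) k'}.
  case: (unliftP (lift j k) j) => [k' jE|/eqP]; first by exists k'.
  by rewrite (negPf (neq_lift _ _)).
have k'E : k' = unbump k j :> nat.
  move/(congr1 (@nat_of_ord _)): jE => /=; rewrite /bump /unbump.
  by move: (nat_of_ord j) (nat_of_ord k) (nat_of_ord k') => a b c; lia.
exists k' => //; split.
- by apply/funext => i; apply/val_inj; rewrite /= bumpC k'E.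
- rewrite k'E /= /bump /unbump !oddD.
  by move: (nat_of_ord j) (nat_of_ord k) => a b; lia.
Qed.

(** Expansion signs along two rows are antisymmetric in the two deleted indices.
In the proof of [chain_moment_euler] this exchanges the row of [l_1] with the last row. *)
Lemma sum_lift2_antisym (K : pzRingType) (V : lmodType K) n
    (H : 'I_n.+2 -> 'I_n.+2 -> ('I_n -> 'I_n.+2) -> V) :
  \sum_(j < n.+2) \sum_(k < n.+1) (-1) ^+ (j + k) *: H j (lift j k) (lift j \o lift k) =
  - \sum_(j < n.+2) \sum_(k < n.+1) (-1) ^+ (j + k) *: H (lift j k) j (lift j \o lift k).
Proof.
rewrite !pair_bigA /= -sumrN.
pose h (p : 'I_n.+2 * 'I_n.+1) := (lift p.1 p.2, s2val (lift_lift_swap p.1 p.2)).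
have hK : involutive h.
  move=> [j k]; rewrite /h /=.
  case: lift_lift_swap => /= k' k'j _; case: lift_lift_swap => /= k'' + _.
  by rewrite k'j => /lift_inj ->.
rewrite (reindex_inj (inv_inj hK)); apply: eq_bigr => -[j k] _ /=.
case: lift_lift_swap => /= k' -> [-> oddE].
by rewrite -signr_odd oddE signrN signr_odd scaleNr.
Qed.

Section IteratedIntegral.
Variable K : numFieldType.

(** The integral of [\det (l_i ^ (e_j - 1))] over [x >= l_1 >= ... >= l_n >= -1],
as a polynomial in [x]: expansion along the row of [l_1], then integration
in [l_1]. *)
Fixpoint chain_moment n : ('I_n -> nat) -> {poly K} :=
  match n with
  | 0%N => fun=> 1
  | m.+1 => fun e =>
    \sum_(j < m.+1) (-1) ^+ j *: primitive ('X^(e j - 1) * chain_moment (e \o lift j))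
  end.

Lemma chain_momentS n (e : 'I_n.+1 -> nat) : chain_moment e =
  \sum_(j < n.+1) (-1) ^+ j *: primitive ('X^(e j - 1) * chain_moment (e \o lift j)).
Proof. by []. Qed.

Arguments chain_moment : simpl never.

Lemma deriv_chain_moment n (e : 'I_n.+1 -> nat) :
  (chain_moment e)^`() =
  \sum_(j < n.+1) (-1) ^+ j *: ('X^(e j - 1) * chain_moment (e \o lift j)).
Proof.
rewrite chain_momentS linear_sum; apply: eq_bigr => j _.
by rewrite linearZ /= deriv_primitive.
Qed.

Lemma chain_moment_start n (e : 'I_n.+1 -> nat) : (chain_moment e).[-1] = 0.
Proof.
rewrite chain_momentS horner_sum big1// => j _.
by rewrite hornerZ horner_primitive mulr0.
Qed.

(** The flux of the Euler field.  On the face [l_1 = x] its outward component is [x],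
which turns the first row [x ^ (e_j - 1)] into [x ^ e_j].  On the face where the
last variable is -1 the outward component is 1, the last row is
[(-1) ^ (e_j - 1) = - (-1) ^ e_j], and its cofactors have sign [(-1) ^ (n + j)].
Differentiating in [x] reduces the identity to the one with an exponent removed. *)
Lemma chain_moment_euler n (e : 'I_n.+1 -> nat) : (forall i, (0 < e i)%N) ->
  (\sum_(j < n.+1) e j)%:R *: chain_moment e =
  \sum_(j < n.+1) (-1) ^+ j *: ('X^(e j) * chain_moment (e \o lift j)) -
  \sum_(j < n.+1) (-1) ^+ (n + j + e j) *: chain_moment (e \o lift j).
Proof.
elim: n e => [|n IHn] e e_gt0; apply: (@poly_eq_deriv _ _ _ (-1)).
- rewrite derivZ deriv_chain_moment !big_ord1 !addn0 !expr0 !scale1r !add0n.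
  rewrite /chain_moment !mulr1 derivB derivXn derivZ derivC scaler0 subr0 subn1.
  by rewrite scaler_nat.
- rewrite !big_ord1 hornerZ chain_moment_start mulr0 !hornerE /chain_moment.
  by rewrite subrr.
- have deriv_sum (f : 'I_n.+2 -> {poly K}) : (\sum_j f j)^`() = \sum_j (f j)^`().
    exact: raddf_sum.
  rewrite derivZ deriv_chain_moment derivB !deriv_sum scaler_sumr.
  (* the induction hypothesis applies to [e] without [e j], whose sum is smaller by [e j] *)
  pose L j k : {poly K} := chain_moment (e \o lift j \o lift k).
  transitivity (\sum_(j < n.+2) \sum_(k < n.+1) (-1) ^+ (j + k) *:
      ('X^(e j - 1) * ('X^(e (lift j k)) * L j k)) +
    \sum_(j < n.+2) \sum_(k < n.+1) (-1) ^+ (j + k) *: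
      ('X^(e j - 1) * (- (-1) ^+ (n + e (lift j k)) *: L j k)) +
    \sum_(j < n.+2) (-1) ^+ j *:
      ('X^(e j - 1) *+ e j * chain_moment (e \o lift j))).
    rewrite -!big_split; apply: eq_bigr => j _ /=.
    rewrite (bigD1_ord j)//= natrD scalerDl [LHS]addrC; congr (_ + _); last first.
      by rewrite scalerA mulrC -scalerA scaler_nat mulrnAl.
    rewrite scalerA mulrC -scalerA scalerAr IHn // mulrBr scalerBr !mulr_sumr !scaler_sumr.
    rewrite -sumrB; rewrite -big_split /=; apply: eq_bigr => k _.
    rewrite -!scalerAr !scalerA -exprD; congr (_ + _).
    rewrite -scaleNr; congr (_ *: _); rewrite mulrN; congr (- _).
    rewrite -!exprD; congr (_ ^+ _); lia.
  rewrite (sum_lift2_antisym (fun j j' f => 'X^(e j - 1) *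
    (- (-1) ^+ (n + e j') *: chain_moment (e \o f)))) -sumrN addrAC.
  rewrite -big_split /= -sumrN; congr (_ + _).
    apply: eq_bigr => j _.
    rewrite derivZ derivM derivXn scalerDr addrC subn1; congr (_ + _).
    rewrite deriv_chain_moment mulr_sumr scaler_sumr; apply: eq_bigr => k _.
    rewrite -scalerAr scalerA exprD; congr (_ *: _).
    rewrite !mulrA -!exprD /L; congr ('X^_ * _); have := e_gt0 j.
    by have := e_gt0 (lift j k); rewrite /=; lia.
  apply: eq_bigr => j _.
  rewrite derivZ deriv_chain_moment scaler_sumr -!sumrN; apply: eq_bigr => k _.
  rewrite -!scalerAr !scalerA -!scaleNr; congr (_ *: _).
  rewrite mulrN opprK !addSn exprS mulN1r mulNr opprK -!exprD; congr (_ ^+ _); lia.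
- rewrite hornerZ chain_moment_start mulr0 hornerD hornerN !horner_sum.
  rewrite !big1 ?subrr// => j _; rewrite hornerZ ?hornerM chain_moment_start.
    by rewrite mulr0.
  by rewrite !mulr0.
Qed.

End IteratedIntegral.

(** * A divided difference *)

(** The monic polynomials with roots [zs] and [y_j] have the same degree [#|A|], so
their difference is its own Lagrange interpolation at the [y_j]; the two sides are
its coefficient of degree [#|A| - 1]. *)
Lemma lagrange_sum (K : fieldType) (I : finType) (A : {pred I}) (y : I -> K)
    (zs : seq K) :
  {in A &, injective y} -> size zs = #|A| ->
  \sum_(j in A) \prod_(z <- zs) (y j - z) / \prod_(k in A | k != j) (y j - y k) =
  \sum_(j in A) y j - \sum_(z <- zs) z.
Proof.
move=> y_inj size_zs; set c := BIG_F.
have [A0|A_gt0] := posnP #|A|.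
  have A_empty : A =i pred0 by apply/card0_eq.
  move: size_zs; rewrite A0 => /size0nil ->.
  by rewrite !(eq_bigl _ _ A_empty) !big_pred0_eq big_nil subr0.
pose ys := [seq y j | j <- enum A].
have size_ys : size ys = #|A| by rewrite size_map -cardE.
pose P := \prod_(z <- zs) ('X - z%:P); pose M := \prod_(z <- ys) ('X - z%:P).
pose L j := \prod_(k in A | k != j) ('X - (y k)%:P).
pose S := \sum_(j in A) c j *: L j.
have size_L j : j \in A -> size (L j) = #|A|.
  move=> Aj; rewrite /L -big_filter size_prod_XsubC size_filter -sum1_count.
  by rewrite -sum1_card [RHS](bigD1 j).
have horner_L j k : j \in A -> k \in A -> (L j).[y k] =
    if k == j then \prod_(i in A | i != j) (y j - y i) else 0.
  move=> Aj Ak; rewrite horner_prod; have [->|kj] := eqVneq.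
    by apply: eq_bigr => i _; rewrite !hornerE.
  by rewrite (bigD1 k) ?Ak //= !hornerE subrr mul0r.
have L_neq0 j : j \in A -> \prod_(i in A | i != j) (y j - y i) != 0.
  move=> Aj; apply/prodf_neq0 => i /andP[Ai ij]; rewrite subr_eq0.
  by apply: contra ij => /eqP/y_inj ->.
have horner_S k : k \in A -> S.[y k] = P.[y k].
  move=> Ak; rewrite horner_sum (bigD1 k) //= big1 => [|j /andP[Aj jk]].
    rewrite addr0 hornerZ horner_L // eqxx divfK ?L_neq0 //.
    by rewrite horner_prod; apply: eq_bigr => z _; rewrite !hornerE.
  by rewrite hornerZ horner_L // eq_sym (negPf jk) mulr0.
have eqPMS : P - M = S.
  apply/eqP; rewrite -subr_eq0; apply/eqP.
  apply: (@roots_geq_poly_eq0 _ _ ys).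
  - apply/allP => x /mapP[k]; rewrite mem_enum => Ak ->{x}.
    rewrite rootE !hornerD !hornerN horner_S // addrAC subrr sub0r oppr_eq0.
    by rewrite -rootE root_prod_XsubC map_f ?mem_enum.
  - by rewrite map_inj_in_uniq ?enum_uniq // => j k; rewrite !mem_enum; apply: y_inj.
  - rewrite size_ys; apply: (leq_trans (size_polyD _ _)); rewrite geq_max.
    rewrite size_polyN; apply/andP; split; last first.
      apply: (leq_trans (size_sum _ _ _)); apply/bigmax_leqP => j Aj.
      by rewrite (leq_trans (size_scale_leq _ _)) // size_L.
    (* both products are monic of the same degree *)
    apply/leq_sizeP => i; rewrite leq_eqVlt => /predU1P[<-|A_lt].
      rewrite coefB.
      have lead rs : size rs = #|A| -> (\prod_(z <- rs) ('X - z%:P))`_#|A| = 1 :> K.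
        move=> size_rs; have := monicP (monic_prod_XsubC rs xpredT id).
        by rewrite lead_coefE size_prod_XsubC size_rs.
      by rewrite !lead // subrr.
    by rewrite nth_default // (leq_trans (size_polyD _ _)) // geq_max size_polyN
      !size_prod_XsubC size_zs size_ys A_lt.
have /esym := congr1 (fun p : {poly K} => p`_#|A|.-1) eqPMS.
rewrite coefB -{2}size_zs -{2}size_ys /P /M !coefPn_prod_XsubC ?size_zs ?size_ys -?lt0n//.
rewrite /ys big_map big_enum /= opprK addrC => <-.
rewrite coef_sum; apply: eq_bigr => j Aj.
rewrite coefZ -{1}(size_L j Aj) -lead_coefE (monicP _) ?mulr1 //.
exact: monic_prod_XsubC.
Qed.

(** * The closed form and its recursion *)

Lemma ltn_lift n (h : 'I_n.+1) (i k : 'I_n) : (lift h i < lift h k)%N = (i < k)%N.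
Proof. by rewrite /= /bump; case: leqP; case: leqP; lia. Qed.

Section ClosedForm.
Variable K : numFieldType.
Implicit Types a b : nat.

(** The sign for mixed parities makes this antisymmetric in [(a, b)], which is why all
the factors containing [e_j] can be written with [e_j] first, at the cost of
[(-1) ^ j], in [closedform_lift]. *)
Definition pairfactor a b : K :=
  if odd a == odd b then b%:R - a%:R else (-1) ^+ (~~ odd a) / (a%:R + b%:R).

Lemma pairfactorC a b : pairfactor a b = - pairfactor b a.
Proof.
rewrite /pairfactor eq_sym; case: eqP => [_|ab] /=; first by rewrite opprB.
rewrite (addrC a%:R) -mulNr; congr (_ / _).
by case: (odd a) (odd b) ab => [] [] //= _; rewrite ?opprK.
Qed.

Definition oddweight a : K := if odd a then a%:R^-1 else 1.

Definition closedform n (e : 'I_n -> nat) : K :=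
  (\prod_(i < n) oddweight (e i)) *
  \prod_(i < n) \prod_(k < n | (i < k)%N) pairfactor (e i) (e k).

Lemma prod_pairs_lift (V : comPzRingType) n (F : 'I_n.+1 -> 'I_n.+1 -> V) (j : 'I_n.+1) :
  \prod_(i < n.+1) \prod_(k < n.+1 | (i < k)%N) F i k =
  (\prod_(k < n) (if (j < lift j k)%N then F j (lift j k) else F (lift j k) j)) *
  \prod_(i < n) \prod_(k < n | (i < k)%N) F (lift j i) (lift j k).
Proof.
have rowj : \prod_(k < n.+1 | (j < k)%N) F j k =
    \prod_(k < n) (if (j < lift j k)%N then F j (lift j k) else 1).
  by rewrite big_mkcond (bigD1_ord j)//= ltnn mul1r.
have row_lift i : \prod_(k < n.+1 | (lift j i < k)%N) F (lift j i) k =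
    (if (lift j i < j)%N then F (lift j i) j else 1) *
    \prod_(k < n | (i < k)%N) F (lift j i) (lift j k).
  rewrite big_mkcond (bigD1_ord j)//=; congr (_ * _); rewrite [RHS]big_mkcond.
  by apply: eq_bigr => k _; rewrite ltn_lift.
rewrite (bigD1_ord j)//= rowj (eq_bigr _ (fun i _ => row_lift i)) big_split mulrA.
rewrite -big_split /=; congr (_ * _); apply: eq_bigr => k _.
have := neq_lift j k; rewrite -val_eqE /= neq_ltn.
by case: ltngtP => //= *; rewrite ?mul1r ?mulr1.
Qed.

Lemma closedform_lift n (e : 'I_n.+1 -> nat) (j : 'I_n.+1) :
  closedform e = (-1) ^+ j * (oddweight (e j) *
    \prod_(k < n.+1 | k != j) pairfactor (e j) (e k)) * closedform (e \o lift j).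
Proof.
have prod_neq (F : 'I_n.+1 -> K) :
    \prod_(k < n.+1 | k != j) F k = \prod_(k < n) F (lift j k).
  rewrite big_mkcond (bigD1_ord j)//= eqxx mul1r.
  by apply: eq_bigr => k _; rewrite eq_sym neq_lift.
have sgn : (-1) ^+ j = \prod_(k < n) (if (lift j k < j)%N then -1 else 1) :> K.
  rewrite -[in LHS](card_ord j) -prodr_const.
  have j_le : (j <= n)%N by rewrite -ltnS.
  rewrite (big_ord_widen n (fun=> -1) j_le) big_mkcond /=; apply: eq_bigr => k _.
  by congr (if _ then _ else _); rewrite /= /bump; lia.
rewrite /closedform (bigD1_ord j)//= (prod_pairs_lift _ j) prod_neq sgn.
rewrite (_ : \prod_(k < n) (if (j < lift j k)%N then _ else _) =
    (\prod_(k < n) (if (lift j k < j)%N then -1 else 1)) *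
    \prod_(k < n) pairfactor (e j) (e (lift j k))).
  by rewrite /comp; ring.
rewrite -big_split; apply: eq_bigr => k _ /=.
have := neq_lift j k; rewrite -val_eqE /= neq_ltn.
by case: ltngtP => //= *; rewrite ?mul1r // mulN1r pairfactorC.
Qed.

(** Relative to [closedform e], the [j]-th term is the inverse of the factors that
contain [e_j]: mixed pairs give the numerator and pairs of equal parity the
denominator of a summand of [lagrange_sum]. *)
Lemma closedform_sum n (e : 'I_n.+1 -> nat) :
  (forall i, (0 < e i)%N) -> injective e ->
  #|[pred i | odd (e i)]| = uphalf n.+1 ->
  \sum_(j < n.+1 | odd (e j) == ~~ odd n) (-1) ^+ j * closedform (e \o lift j) =
  (-1) ^+ (if odd n then 1 else n./2) * (\sum_(j < n.+1) e j)%:R * closedform e.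
Proof.
move=> e_gt0 e_inj odd_e.
set A := [pred j | odd (e j) == ~~ odd n].
have cardA : #|A| = (n./2).+1.
  have [n_odd|n_even] := boolP (odd n).
    have := cardC [pred i | odd (e i)]; rewrite odd_e card_ord.
    have -> : #|[predC [pred i | odd (e i)]]| = #|A|.
      by apply: eq_card => i; rewrite !inE n_odd eqbF_neg.
    by have := odd_double_half n; rewrite n_odd; lia.
  by rewrite -[RHS]odd_e; apply: eq_card => i; rewrite !inE n_even eqb_id.
have cardCA : #|[predC A]| = (uphalf n).
  have : (#|A| + #|[predC A]| = n.+1)%N by rewrite cardC card_ord.
  by rewrite cardA uphalf_half; have := odd_double_half n; lia.
(* the root 0 matches the factor [oddweight (e j)], present when [A] is the odd class *)
pose zs : seq K := (if odd n then [::] else [:: 0]) ++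
  [seq - (e k)%:R | k <- enum [predC A]].
have size_zs : size zs = #|A|.
  by rewrite size_cat size_map -cardE cardCA cardA uphalf_half; case: (odd n) => /=; lia.
pose y (j : 'I_n.+1) : K := (e j)%:R.
have y_inj : {in A &, injective y}.
  by move=> i j _ _ /eqP; rewrite eqr_nat => /eqP/e_inj.
have sum_e : (\sum_(j < n.+1) e j)%:R = \sum_(j in A) y j - \sum_(z <- zs) z.
  rewrite big_cat /= big_map big_enum /= natr_sum (bigID (mem A)) /=.
  rewrite sumrN opprD opprK; congr (_ + _).
  by case: ifP => _; rewrite ?big_nil ?big_seq1 oppr0 add0r.
rewrite sum_e -(lagrange_sum y_inj size_zs) mulr_sumr mulr_suml.
apply: eq_bigr => j Aj.
set D := \prod_(k in A | k != j) _.
pose E : K := \prod_(k | ~~ A k) ((e j)%:R + (e k)%:R).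
have D_neq0 : D != 0.
  apply/prodf_neq0 => k /andP[Ak kj]; rewrite subr_eq0.
  by apply: contra kj => /eqP/y_inj ->.
have E_neq0 : E != 0.
  by apply/prodf_neq0 => k _; rewrite -natrD pnatr_eq0 addn_eq0 negb_and -lt0n e_gt0.
have j_odd : odd (e j) = ~~ odd n by apply/eqP.
have same : \prod_(k | (k != j) && A k) pairfactor (e j) (e k) = (-1) ^+ n./2 * D.
  transitivity (\prod_(k | A k && (k != j)) ((-1) * (y j - y k))).
    apply: eq_big => [k|k /andP[_ /eqP k_odd]]; first by rewrite andbC.
    by rewrite /pairfactor j_odd k_odd eqxx mulN1r opprB.
  rewrite big_split prodr_const; congr (_ ^+ _ * _).
  have := cardD1 j A; rewrite cardA [j \in A]Aj add1n => -[->].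
  by apply: eq_card => k; rewrite !inE andbC.
have diff : \prod_(k | (k != j) && ~~ A k) pairfactor (e j) (e k) =
    (-1) ^+ (odd n * uphalf n) / E.
  transitivity (\prod_(k | ~~ A k) ((-1) ^+ odd n / ((e j)%:R + (e k)%:R) : K)).
    apply: eq_big => [k|k /andP[_ k_odd]].
      by case: eqVneq => // ->; rewrite [A j]Aj.
    have {k_odd} : odd (e k) != ~~ odd n by [].
    by rewrite /pairfactor j_odd negbK eq_sym => /negPf ->.
  rewrite prodf_div prodr_const exprM; congr (_ ^+ _ / _).
  by rewrite -cardCA; apply: eq_card => k.
have interp : \prod_(z <- zs) (y j - z) = (if odd n then 1 else (e j)%:R) * E.
  rewrite big_cat /= big_map big_enum /=; congr (_ * _).
    by case: ifP => _; rewrite ?big_nil ?big_seq1 ?subr0.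
  by apply: eq_bigr => k _; rewrite opprK.
have weight : oddweight (e j) * (if odd n then 1 else (e j)%:R) = 1.
  rewrite /oddweight j_odd; case: (odd n) => /=; first by rewrite mulr1.
  by rewrite mulVf // pnatr_eq0 -lt0n.
have sign : (-1) ^+ n./2 * (-1) ^+ (odd n * uphalf n) *
    (-1) ^+ (if odd n then 1 else n./2)%N = 1 :> K.
  rewrite -!exprD -signr_odd !oddD oddM uphalf_half oddD oddb.
  by case: (odd n) => /=; case: (odd n./2).
rewrite (closedform_lift e j) interp (bigID A) /= same diff.
transitivity ((-1) ^+ n./2 * (-1) ^+ (odd n * uphalf n) *
    (-1) ^+ (if odd n then 1 else n./2)%N *
    (oddweight (e j) * (if odd n then 1 else (e j)%:R)) *
    ((-1) ^+ j * closedform (e \o lift j))).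
  by rewrite sign weight !mul1r.
move: (closedform _) (oddweight _) => G w.
set c1 := _ ^+ n./2; set c2 := _ ^+ (_ * _); set c3 := _ ^+ (if _ then _ else _).
set c4 := _ ^+ j; set x := (if _ then _ else _).
move: c1 c2 c3 c4 x => *.
by field; rewrite D_neq0 E_neq0.
Qed.

(** The first binomial is the sign in the theorem, and the second one undoes the signs
that [pairfactor] carries for arranged exponents, see [closedform_arranged]. *)
Definition closedform_sign n : K := (-1) ^+ ('C(n, 2) + 'C(uphalf n, 2)).

Lemma closedform_signS n :
  closedform_sign n.+1 = (-1) ^+ (if odd n then 1 else n./2) * closedform_sign n.
Proof.
rewrite /closedform_sign -exprD -signr_odd -[RHS]signr_odd; congr (_ ^+ nat_of_bool _).
rewrite -(odd_double_half n) binS bin1; move: (odd n) n./2 => b m.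
case: b; rewrite ?add1n ?add0n /= !(odd_double, uphalf_double, doubleK) /=.
  by rewrite add0n !oddD /= odd_double addbT addNb.
by rewrite binS bin1 !oddD odd_double addbF addbA [RHS]addbC.
Qed.

(** A pair of positions counts -1 when an even one precedes an odd one, and the odd
position [2 k + 1] is preceded by [k] even ones. *)
Lemma prod_sign_arranged n :
  \prod_(i < n) \prod_(j < n | (i < j)%N && (odd i.+1 != odd j.+1))
    (-1) ^+ odd i = (-1) ^+ 'C(uphalf n, 2) :> K.
Proof.
have inner (b : bool) m : \prod_(i < m | odd i != b) (-1) ^+ odd i =
    (-1) ^+ (if b then 0 else m./2)%N :> K.
  elim: m => [|m IHm]; first by rewrite big_ord0; case: b.
  rewrite big_mkcond big_ord_recr -big_mkcond /= IHm uphalf_half.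
  by case: b {IHm}; case: (odd m); rewrite /= ?add0n ?add1n ?exprSr ?expr0 ?mulr1 ?mul1r.
rewrite (exchange_big_dep xpredT) //=.
transitivity (\prod_(j < n) ((-1) ^+ (if odd j then 0 else j./2)%N : K)).
  apply: eq_bigr => j _; rewrite -inner.
  rewrite (big_ord_widen_cond n (fun i => odd i != odd j) (fun i => (-1) ^+ odd i)) 1?ltnW //.
  apply: eq_bigl => i; rewrite andbC; congr (_ && _).
  by case: (odd i) (odd j) => [][].
elim: n => [|n IHn]; first by rewrite big_ord0.
rewrite big_ord_recr IHn [uphalf n.+1]/= uphalf_half /=.
case: (odd n); rewrite ?mulr1 ?add1n ?add0n //.
by rewrite binS bin1 exprD.
Qed.

Lemma closedform_arranged n (a : 'I_n -> nat) :
  (forall i, odd (a i) = odd i.+1) ->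
  closedform a = (-1) ^+ 'C(uphalf n, 2) *
    ((\prod_(i < n) \prod_(j < n | (i < j)%N && (odd i.+1 == odd j.+1))
            ((a j)%:R - (a i)%:R)) /
         ((\prod_(i < n | odd i.+1) (a i)%:R) *
          (\prod_(i < n) \prod_(j < n | (i < j)%N && (odd i.+1 != odd j.+1))
            ((a i)%:R + (a j)%:R)))).
Proof.
move=> a_odd; rewrite /closedform -prod_sign_arranged.
have -> : \prod_(i < n) oddweight (a i) = (\prod_(i < n | odd i.+1) (a i)%:R)^-1.
  rewrite -prodfV [RHS]big_mkcond; apply: eq_bigr => i _.
  by rewrite /oddweight a_odd; case: ifP.
set X := \prod_(i < n | _) _; rewrite invfM mulrCA !mulrA [_ / X]mulrC -!mulrA.
congr (_ * _); rewrite -prodf_div -!big_split /=; apply: eq_bigr => i _.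
rewrite (bigID (fun j : 'I_n => odd i.+1 == odd j.+1)) /=; congr (_ * _).
  apply: eq_bigr => j /andP[_ ij]; by rewrite /pairfactor !a_odd ij.
rewrite -prodf_div; apply: eq_bigr => j /andP[_ ij].
by rewrite /pairfactor !a_odd (negPf ij) /= negbK.
Qed.

End ClosedForm.

(** * Integration over the ordered chain *)

Import numFieldNormedType.Exports.
Local Open Scope classical_set_scope.
Local Open Scope ring_scope.

Section IntegralOverChain.
Variable R : realType.
Local Notation B := (measurableTypeR R).
Local Notation lam := (@lebesgue_measure R).

(** Fubini for the first coordinate. *)
Lemma integral_lebesgue_tupleS n (f : n.+1.-tuple B -> \bar R) :
  (lebesgue_tuple R n.+1).-integrable setT f ->
  (\int[lebesgue_tuple R n.+1]_t f t =
   \int[lam]_x \int[lebesgue_tuple R n]_t f (cons_pair (x, t)))%E.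
Proof.
move=> intf; have mf := measurable_int _ intf.
have mphi := @measurable_cons_pair R n.
have intfphi : (lam \x lebesgue_tuple R n)%E.-integrable setT (f \o cons_pair).
  apply/integrableP; split; first exact: (measurable_comp measurableT (@subsetT _ _) mf mphi).
  have /integrableP[_] := intf; apply: le_lt_trans.
  rewrite /= /lebesgue_cons ge0_integral_pushforward//.
  exact: measurable_int (integrable_abse intf).
rewrite [LHS](integral_pushforward mphi mf)// preimage_setT.
by rewrite -integral12_prod_meas1.
Qed.

Definition chain n (x : R) : set (n.-tuple B) :=
  [set t | path (fun x y : R => y <= x) x (rcons t (-1))].

Lemma measurable_chain n x : measurable (@chain n x).
Proof.
rewrite (_ : chain x = \bigcap_(i in [set` 'I_n.+1])
  [set t : n.-tuple B | nth 0 (rcons t (-1)) i <= nth 0 (x :: rcons t (-1)) i]).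
  apply: fin_bigcap_measurable => // i _.
  have mr (k : nat) : measurable_fun [set: n.-tuple B]
      (fun t : n.-tuple B => nth 0 (rcons t (-1)) k : R).
    have [kn|nk] := ltnP k n.
      rewrite (_ : (fun _ => _) = (fun t => tnth t (Ordinal kn))).
        exact: measurable_tnth.
      by apply/funext => t; rewrite nth_rcons size_tuple kn (tnth_nth 0).
    rewrite (_ : (fun _ => _) = cst (if k == n then -1 else 0)) //.
    by apply/funext => t; rewrite nth_rcons size_tuple ltnNge nk.
  have mx : measurable_fun [set: n.-tuple B]
      (fun t : n.-tuple B => nth 0 (x :: rcons t (-1)) i : R).
    by case: (nat_of_ord i) => [|k] /=.
  rewrite -[X in measurable X]setTI.
  exact: measurable_fun_le.
apply/seteqP; split => t /=.
  by move=> /(pathP 0) + i _; apply; rewrite size_rcons size_tuple.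
move=> h; apply/(pathP 0) => i; rewrite size_rcons size_tuple => i_lt.
exact: (h (Ordinal i_lt)).
Qed.

(** A chain stays in the cube [[-1, x]^n], which has finite measure. *)
Lemma chain_bounds n x (t : n.-tuple B) : chain x t ->
  -1 <= x /\ forall i, -1 <= tnth t i <= x.
Proof.
have bounds (s : seq R) y : path (fun x y : R => y <= x) y (rcons s (-1)) ->
    -1 <= y /\ {in s, forall z, -1 <= z <= y}.
  elim: s y => [y /andP[]|z s IHs y /andP[zy /IHs[z_ge s_itv]]] //=.
  split=> [|u]; first exact: le_trans zy.
  rewrite inE => /predU1P[->|/s_itv/andP[-> uz]]; first by rewrite z_ge.
  exact: le_trans zy.
by move=> /bounds[x_ge t_itv]; split=> // i; apply/t_itv/mem_tnth.
Qed.

Lemma chain_cons n x u (t : n.-tuple B) :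
  chain x (cons_pair (u, t)) <-> u <= x /\ chain u t.
Proof. by rewrite /chain /=; split => [/andP[]|[-> ->]]. Qed.

Definition moment_det n (e : 'I_n -> nat) (t : n.-tuple B) : R :=
  \det (\matrix_(i < n, j < n) (tnth t i : R) ^+ (e j - 1)).

Lemma measurable_moment_det n (e : 'I_n -> nat) :
  measurable_fun [set: n.-tuple B] (moment_det e).
Proof.
rewrite /moment_det /determinant; apply: measurable_sum => s.
apply: measurable_funM => //; apply: measurable_prod => i _.
rewrite (_ : (fun _ => _) = (fun t : n.-tuple B => (tnth t i : R) ^+ (e (s i) - 1))).
  by apply: measurable_funX; exact: measurable_tnth.
by apply/funext => t; rewrite mxE.
Qed.

Lemma integrable_moment_det n (e : 'I_n -> nat) x : x <= 1 ->
  (lebesgue_tuple R n).-integrable (chain x) (EFin \o moment_det e).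
Proof.
move=> x1; apply: measurable_bounded_integrable.
- exact: measurable_chain.
- apply: (@le_lt_trans _ _ (lebesgue_tuple R n
      [set t | forall i, (`[-1, 1]%classic : set B) (tnth t i)])).
    apply: le_measure; rewrite ?inE.
    + exact: measurable_chain.
    + rewrite (_ : [set t | _] = \bigcap_(i in [set: 'I_n])
        ((fun t : n.-tuple B => tnth t i) @^-1` `[-1, 1]%classic)).
        apply: fin_bigcap_measurable => // i _.
        by rewrite -[X in measurable X]setTI; exact: measurable_tnth.
      by apply/seteqP; split => t /= h i; [move=> _|]; exact: h.
    + move=> t xt i /=; rewrite in_itv /=.
      by have [_ /(_ i)/andP[-> /le_trans ->]] := chain_bounds xt.
  rewrite (@lebesgue_tuple_box R n (fun=> `[-1, 1]%classic)) //.
  rewrite ltey_eq prode_fin_num // => i _.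
  by rewrite lebesgue_measure_itv /=; case: ifP.
- exact: measurable_funTS (measurable_moment_det e).
- exists (n`!%:R); split => // M M_gt t xt.
  apply: le_trans (ltW M_gt); rewrite /moment_det /determinant.
  apply: le_trans (ler_norm_sum _ _ _) _.
  rewrite -card_Sn -sum1_card natr_sum; apply: ler_sum => s _.
  rewrite normrM normr_sign mul1r normr_prod.
  rewrite -[leRHS](@big1 _ 1 *%R _ (index_enum 'I_n) xpredT (fun=> 1)) //.
  apply: ler_prod => i _; rewrite mxE normr_ge0 normrX exprn_ile1 //.
  have [_ /(_ i)/andP[tl tu]] := chain_bounds xt.
  by rewrite ler_norml tl (le_trans tu).
Qed.

Lemma moment_det_cons n (e : 'I_n.+1 -> nat) u (t : n.-tuple B) :
  moment_det e (cons_pair (u, t)) =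
  \sum_(j < n.+1) (-1) ^+ j * u ^+ (e j - 1) * moment_det (e \o lift j) t.
Proof.
rewrite /moment_det (expand_det_row _ ord0); apply: eq_bigr => j _.
rewrite mxE /cofactor /= add0n mulrCA mulrA; congr (_ * \det _).
by apply/matrixP => i k; rewrite !mxE /= tnthS.
Qed.

Lemma integral_horner (p : {poly R}) a b : a <= b ->
  (\int[lam]_(u in `[a, b]) (p^`().[u])%:E = (p.[b] - p.[a])%:E)%E.
Proof.
rewrite le_eqVlt => /predU1P[->|ab].
  by rewrite set_itv1 integral_set1 subrr.
rewrite (@continuous_FTC2 _ _ (horner p)) //.
- by apply: continuous_subspaceT => u; exact: continuous_horner.
- split=> [u _||].
  + exact: derivable_horner.
  + by apply: cvg_at_right_filter; exact: continuous_horner.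
  + by apply: cvg_at_left_filter; exact: continuous_horner.
- by move=> u _; rewrite derivE.
Qed.

(** Fixing the first coordinate [u], the inner integral is the derivative of
[chain_moment e] at [u] for [u] in [[-1, x]], and 0 elsewhere. *)
Lemma integral_moment_det n (e : 'I_n -> nat) x : -1 <= x <= 1 ->
  (\int[lebesgue_tuple R n]_(t in chain x) (moment_det e t)%:E =
   ((chain_moment R e).[x])%:E)%E.
Proof.
elim: n e x => [|n IHn] e x /andP[x_ge x_le].
  rewrite integral_dirac; last 2 first.
  - exact: measurable_chain.
  - apply/measurable_EFinP/measurable_funTS; exact: measurable_moment_det.
  rewrite /moment_det det_mx00 /chain_moment hornerC mule1 diracE mem_set //.
  by rewrite /chain /= x_ge.
pose p := (chain_moment R e)^`().
have inner u : (\int[lebesgue_tuple R n]_t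
    ((EFin \o moment_det e) \_ (chain x)) (cons_pair (u, t)) =
  ((EFin \o horner p) \_ `[(-1)%R, x]) u)%E.
  have cons_mem t : (cons_pair (u, t) \in chain x) = (u <= x) && (t \in chain u).
    by apply/idP/andP; rewrite !in_setE => /chain_cons.
  rewrite patchE; case: ifPn => [/set_mem|u_out].
    rewrite /= in_itv /= => /andP[u_ge ux].
    transitivity (\int[lebesgue_tuple R n]_(t in chain u)
      \sum_(j < n.+1) (((-1) ^+ j * u ^+ (e j - 1))%R%:E *
         (moment_det (e \o lift j) t)%:E))%E.
      rewrite [RHS]integral_mkcond; apply: eq_integral => t _.
      rewrite !patchE cons_mem ux /=; case: ifP => // _.
      by rewrite moment_det_cons -sumEFin.
    have int_j j : (lebesgue_tuple R n).-integrable (chain u)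
        (EFin \o moment_det (e \o lift j)).
      by apply: integrable_moment_det; exact: le_trans ux x_le.
    rewrite integral_sum //; last 2 first.
    - exact: measurable_chain.
    - by move=> j; exact: (integrableZl (measurable_chain u) _ (int_j j)).
    rewrite /p deriv_chain_moment horner_sum -sumEFin; apply: eq_bigr => j _.
    rewrite (integralZl (measurable_chain u) (int_j j)).
    rewrite IHn ?u_ge ?(le_trans ux) //.
    by rewrite hornerZ hornerM hornerXn -EFinM mulrA.
  apply: integral0_eq => t _; rewrite patchE cons_mem; case: ifPn => //.
  case/andP => ux; rewrite in_setE => /chain_bounds[u_ge _].
  by move: u_out; rewrite notin_setE /= in_itv /= u_ge ux.
rewrite integral_mkcond integral_lebesgue_tupleS; last first.
  apply/(integrable_mkcond _ (measurable_chain x)).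
  exact: integrable_moment_det.
under eq_integral do rewrite inner.
rewrite -integral_mkcond integral_horner // chain_moment_start subr0 //.
Qed.

End IntegralOverChain.

(** * Evaluation of the integral *)

Section FInt.
Variable R : realType.

Lemma f_intE n (e : 'I_n -> nat) : f_int R e = (chain_moment R e).[1].
Proof.
rewrite /f_int /Rintegral (integral_moment_det e) //.
by apply/andP; split; lra.
Qed.

Lemma f_int_perm n (e : 'I_n -> nat) (s : 'S_n) :
  f_int R (perm_vec s e) = (-1) ^+ s * f_int R e.
Proof.
have intf := @integrable_moment_det R n e 1 (lexx _).
rewrite /f_int -(RintegralZl _ (measurable_chain 1) intf).
apply: eq_Rintegral => t _; rewrite /moment_det /=.
rewrite -det_perm mulrC -det_mulmx -[s in RHS]invgK -col_permE.
by congr (\det _); apply/matrixP => i j; rewrite !mxE.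
Qed.

Lemma f_int_eq0 n (e : 'I_n -> nat) i j : i != j -> e i = e j -> f_int R e = 0.
Proof.
move=> ij eij; rewrite /f_int /Rintegral integral0_eq // => t _; congr EFin.
rewrite -det_tr; apply: (determinant_alternate ij) => k.
by rewrite !mxE eij.
Qed.

Lemma f_int_rec n (e : 'I_n.+1 -> nat) : (forall i, (0 < e i)%N) ->
  (\sum_(j < n.+1) e j)%:R * f_int R e =
  2 * \sum_(j < n.+1 | odd (e j) == ~~ odd n) (-1) ^+ j * f_int R (e \o lift j).
Proof.
move=> e_gt0; rewrite f_intE -hornerZ chain_moment_euler // hornerD hornerN.
rewrite !horner_sum -sumrB mulr_sumr [RHS]big_mkcond; apply: eq_bigr => j _.
rewrite !hornerZ hornerM hornerXn expr1n mul1r f_intE -mulrBl mulrA.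
rewrite -signr_odd -[(-1) ^+ (n + j + e j)]signr_odd !oddD.
case: eqP => [->|/eqP]; first by case: (odd n) (odd j) => [][]; rewrite /= ?expr0 ?expr1; ring.
by case: (odd n) (odd j) (odd (e j)) => [][][] //= _; rewrite subrr mul0r.
Qed.

Lemma closedform_eq0 n (e : 'I_n -> nat) i j :
  i != j -> e i = e j -> closedform R e = 0.
Proof.
wlog ij : i j / (i < j)%N => [wlog_ij ij eij|_ eij].
  have := ij; rewrite -val_eqE neq_ltn => /orP[] lt_ij.
    exact: (wlog_ij i j).
  by apply: (wlog_ij j i); rewrite 1?eq_sym.
rewrite /closedform [X in _ * X](bigD1 i) //= [X in _ * (X * _)](bigD1 j) //=.
by rewrite {1}/pairfactor eij eqxx subrr mul0r mul0r mulr0.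
Qed.

Lemma N_odd_lift n (e : 'I_n.+1 -> nat) j :
  N_odd e = (odd (e j) + N_odd (e \o lift j))%N.
Proof.
rewrite /N_odd -!sum1_card [LHS]big_mkcond (bigD1_ord j) //= [in RHS]big_mkcond.
by congr (_ + _)%N; case: ifP; rewrite inE => ->.
Qed.

Lemma N_odd_uphalf n (e : 'I_n -> nat) :
  ((N_odd e)%:Z - (N_even e)%:Z \in [:: 0; 1]) = (N_odd e == uphalf n).
Proof.
have : (N_odd e + N_even e)%N = n.
  by rewrite -[RHS](card_ord n) -(cardC [pred i | odd (e i)]).
move: (N_odd e) (N_even e) => a b ab.
by rewrite !inE; have := odd_double_half n; rewrite uphalf_half; lia.
Qed.

Lemma N_odd_perm n (e : 'I_n -> nat) (s : 'S_n) : N_odd (perm_vec s e) = N_odd e.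
Proof.
rewrite /N_odd -!sum1_card [RHS](reindex_inj (@perm_inj _ s^-1%g)) /=.
by apply: eq_bigl => i; rewrite !inE.
Qed.

(** Repeated exponents are treated apart: both sides vanish, while the recursion for
the closed form divides by differences of exponents. *)
Lemma f_int_closedform n (e : 'I_n -> nat) : (forall i, (0 < e i)%N) ->
  f_int R e = (N_odd e == uphalf n)%:R *
    (closedform_sign R n * 2 ^+ n * closedform R e).
Proof.
elim: n e => [|n IHn] e e_gt0.
  rewrite f_intE /chain_moment hornerC /N_odd eq_card0 => [|[]//].
  by rewrite eqxx /closedform_sign /closedform !big_ord0 !bin0n expr0 !mul1r.
have sum_gt0 : (0 < \sum_(j < n.+1) e j)%N.
  by rewrite big_ord_recl addn_gt0 e_gt0.
have [/injectiveP e_inj|] := boolP (injectiveb e); last first.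
  case/injectivePn => i [j ij eij].
  by rewrite (f_int_eq0 ij eij) (closedform_eq0 ij eij) !mulr0.
have sum_neq0 : (\sum_(j < n.+1) e j)%:R != 0 :> R by rewrite pnatr_eq0 -lt0n.
apply: (mulfI sum_neq0); rewrite f_int_rec //.
have N_odd_match j : odd (e j) == ~~ odd n ->
    (N_odd (e \o lift j) == uphalf n) = (N_odd e == uphalf n.+1).
  move=> /eqP ej; rewrite (N_odd_lift e j) ej uphalf_half /=.
  by rewrite -(eqn_add2l (~~ odd n)); case: (odd n); rewrite ?add0n ?add1n.
transitivity ((N_odd e == uphalf n.+1)%:R * (closedform_sign R n * 2 ^+ n.+1) *
    \sum_(j < n.+1 | odd (e j) == ~~ odd n) (-1) ^+ j * closedform R (e \o lift j)).
  rewrite !mulr_sumr; apply: eq_bigr => j /N_odd_match Nj.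
  rewrite IHn => [|i]; last exact: e_gt0.
  by rewrite Nj exprS; ring.
case: eqP => [N_e|_]; last by rewrite !mul0r mulr0.
by rewrite closedform_sum // closedform_signS; ring.
Qed.
End FInt.

(** * Parity arrangements *)

Lemma parity_arrangedP n (a : 'I_n -> nat) :
  parity_arranged a <-> forall i, odd (a i) = odd i.+1.
Proof.
rewrite /parity_arranged; split=> a_mod i; last by rewrite !modn2 a_mod.
by have := a_mod i; rewrite !modn2; case: (odd _) (odd _) => [][].
Qed.

Lemma perm_eq_bool (s t : seq bool) :
  size s = size t -> count id s = count id t -> perm_eq s t.
Proof.
move=> size_st count_st; apply/allP => b _ /=; apply/eqP.
case: b; first by rewrite !(@eq_count _ (pred1 true) id) // => -[].
rewrite !(@eq_count _ (pred1 false) (predC id)); do 1?by case.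
by have := count_predC id s; rewrite size_st -(count_predC id t) count_st => /addnI.
Qed.

Lemma count_odd_ord n : count id [seq odd (i : 'I_n).+1 | i <- enum 'I_n] = uphalf n.
Proof.
rewrite (map_comp (fun i => odd i.+1) (@nat_of_ord n)) val_enum_ord.
elim: n => // n IHn.
rewrite -addn1 iotaD map_cat count_cat IHn /= add0n addn0 /=.
by rewrite addn1 uphalf_half /=; case: (odd n); rewrite ?addn0 ?addn1.
Qed.

(** The two sequences of parities have as many odd entries, hence are permutations of
each other. *)
Lemma exists_parity_arranged n (e : 'I_n -> nat) : N_odd e = uphalf n ->
  exists s : 'S_n, parity_arranged (perm_vec s e).
Proof.
move=> N_e.
have perm_par : perm_eq [tuple odd i.+1 | i < n] [tuple odd (e i) | i < n].
  apply: perm_eq_bool; first by rewrite !size_tuple.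
  transitivity (uphalf n); first exact: count_odd_ord.
  rewrite -N_e /N_odd /= count_map cardE /enum_mem -enumT size_filter.
  by rewrite filter_predT; apply: eq_count => i.
have /tuple_permP[p pE] := perm_par.
exists p^-1%g; apply/parity_arrangedP => i; rewrite /perm_vec invgK.
have := congr1 (fun s => nth false s i) pE.
by rewrite -!tnth_nth !tnth_mktuple.
Qed.

Theorem theorem9 (R : realType) (n : nat) (e : 'I_n -> nat)
    (e_gt0 : forall i, (0 < e i)%N) :
  (forall s : 'S_n, f_int R (perm_vec s e) = (-1) ^+ s * f_int R e) /\
  ((N_odd e)%:Z - (N_even e)%:Z \notin [:: 0; 1] -> f_int R e = 0) /\
  ((N_odd e)%:Z - (N_even e)%:Z \in [:: 0; 1] ->
    (exists s : 'S_n, parity_arranged (perm_vec s e)) /\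
    (forall s : 'S_n, parity_arranged (perm_vec s e) ->
      let a := perm_vec s e in
      f_int R a =
        (-1) ^+ 'C(n, 2) * 2 ^+ n *
        ((\prod_(i < n) \prod_(j < n | (i < j)%N && (odd i.+1 == odd j.+1))
            ((a j)%:R - (a i)%:R)) /
         ((\prod_(i < n | odd i.+1) (a i)%:R) *
          (\prod_(i < n) \prod_(j < n | (i < j)%N && (odd i.+1 != odd j.+1))
            ((a i)%:R + (a j)%:R)))))).
Proof.
rewrite N_odd_uphalf; split; first exact: f_int_perm.
split=> [/negPf N_e|/eqP N_e]; first by rewrite f_int_closedform // N_e mul0r.
split=> [|s /parity_arrangedP a_odd a]; first exact: exists_parity_arranged.
rewrite /a f_int_closedform => [|i]; last exact: e_gt0.
rewrite N_odd_perm N_e eqxx mul1r (closedform_arranged _ a_odd).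
rewrite /closedform_sign exprD; set c := (-1) ^+ 'C(uphalf n, 2).
have cc : c * c = 1 by rewrite -exprMn mulN1r opprK expr1n.
by rewrite [LHS]mulrA; congr (_ * _); rewrite mulrAC -(mulrA _ c c) cc mulr1.
Qed.
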